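(* Let $q$ be a prime power and suppose that $U_1,U_2,\dots,U_{q+1}$ form a partition of $\mathbb{P}^2(\mathbb{F}_q)$, where some of the sets $U_i$ are allowed to be empty. Then there exists a pencil of plane curves $\mathcal{L}=\langle F,G\rangle$ over $\mathbb{F}_q$ whose base locus has no $\mathbb{F}_q$-points such that $\mathcal{L}$ induces the partition $\{U_i\}_{i=1}^{q+1}$.
   Context: A pencil of plane curves $\mathcal{L}=\langle F,G\rangle$ over $\mathbb{F}_q$ is given by two linearly independent homogeneous polynomials $F,G\in\mathbb{F}_q[x,y,z]$ of the same degree $d\ge 1$. Its $\mathbb{F}_q$-members are the $q+1$ plane curves $C_{[s:t]}=\{sF+tG=0\}\subset\mathbb{P}^2$ for $[s:t]\in\mathbb{P}^1(\mathbb{F}_q)$. The base locus has no $\mathbb{F}_q$-points if there is no $P\in\mathbb{P}^2(\mathbb{F}_q)$ with $F(P)=G(P)=0$; in this case the sets $C_{[s:t]}(\mathbb{F}_q)$, $[s:t]\in\mathbb{P}^1(\mathbb{F}_q)$, are pairwise disjoint with union $\mathbb{P}^2(\mathbb{F}_q)$ (some of them possibly empty). A partition into $q+1$ sets means that the $U_i$ are pairwise disjoint subsets with union $\mathbb{P}^2(\mathbb{F}_q)$. Such a pencil $\mathcal{L}$ induces the partition $\{U_i\}_{i=1}^{q+1}$ if there is a bijection $\sigma:\mathbb{P}^1(\mathbb{F}_q)\to\{1,\dots,q+1\}$ with $C_{[s:t]}(\mathbb{F}_q)=U_{\sigma([s:t])}$ for every $[s:t]\in\mathbb{P}^1(\mathbb{F}_q)$.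 *)

(* Defs.v *)
From mathcomp Require Import all_boot all_order all_algebra.
From mathcomp Require Import mpoly.

Set Implicit Arguments.
Unset Strict Implicit.
Unset Printing Implicit Defensive.

Import GRing.Theory.
Local Open Scope ring_scope.

Section ProjectiveSpace.

Variables (K : finFieldType) (n : nat).

Definition proportional (v w : 'rV[K]_n.+1) : bool :=
  [exists a : K, (a != 0) && (w == a *: v)].

(* Needed for equivalence_partition below to be a genuine quotient. *)
Lemma proportional_equiv : equivalence_rel proportional.
Proof.
apply/equivalence_relP; split=> [v|v w /existsP[a /andP[a0 /eqP->]] u].
  by apply/existsP; exists 1; rewrite oner_neq0 scale1r eqxx.
apply/existsP/existsP=> -[b /andP[b0 /eqP->]].
  by exists (b / a); rewrite mulf_neq0 ?invr_eq0 // scalerA divfK ?eqxx.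
by exists (b * a); rewrite mulf_neq0 // scalerA eqxx.
Qed.

(* A point is the full class of its homogeneous coordinate vectors, zero
   excluded. *)
Definition proj_points : {set {set 'rV[K]_n.+1}} :=
  equivalence_partition proportional [set v | v != 0].

Definition proj : Type := {P : {set 'rV[K]_n.+1} | P \in proj_points}.

End ProjectiveSpace.

Section Pencils.

Variable K : finFieldType.

Definition on_curve (F : {mpoly K[3]}) (P : proj K 2) : bool :=
  [forall v in val P, F.@[v 0] == 0].

(* d is the common degree of the two generators. *)
Definition is_pencil (d : nat) (F G : {mpoly K[3]}) : Prop :=
  [/\ (0 < d)%N, F \is d.-homog, G \is d.-homog
    & forall a b : K, a *: F + b *: G = 0 -> a = 0 /\ b = 0].

(* The K-points of C_[s:t]; rescaling (s, t) multiplies s F + t G by a nonzero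
   constant, so the condition does not depend on the representative. *)
Definition member (F G : {mpoly K[3]}) (st : proj K 1) : {set proj K 2} :=
  [set P | [forall c in val st, on_curve (c 0 0 *: F + c 0 1 *: G) P]].

Definition base_point_free (F G : {mpoly K[3]}) : Prop :=
  ~ exists P : proj K 2, on_curve F P /\ on_curve G P.

(* finset's partition is not used: it is unindexed and excludes empty blocks. *)
Definition is_partition (I : finType) (U : I -> {set proj K 2}) : Prop :=
  (forall i j, i != j -> [disjoint U i & U j]) /\
  \bigcup_i U i = [set: proj K 2].

Definition induces (I : finType) (F G : {mpoly K[3]})
    (U : I -> {set proj K 2}) : Prop :=
  exists sigma : proj K 1 -> I,
    bijective sigma /\ forall st, member F G st = U (sigma st).

End Pencils.

(* Main.v *)
(* Choose a bijection between P^1(F_q) and the index set. If P lies in the block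
   attached to [s : t], prescribe (F, G)(P) = (t, -s); then s' F + t' G vanishes
   at P exactly when [s' : t'] = [s : t]. The products in [point_indicator] give
   forms of degree 3 (q - 1) with these values. The interpolants may be
   proportional as polynomials (when all blocks but one are empty); adding
   to one of them a nonzero form of the same degree that vanishes at every
   F_q-point makes them independent. *)
Require Import Defs.
From mathcomp Require Import all_boot all_order all_algebra all_field.
From mathcomp Require Import mpoly.

Set Implicit Arguments.
Unset Strict Implicit.
Unset Printing Implicit Defensive.

Import GRing.Theory.
Local Open Scope ring_scope.

(** * Projective points as classes of vectors, and their number *)

Section ProjectivePoints.

Variables (K : finFieldType) (n : nat).

Lemma projP (P : proj K n) :
  exists2 v, v != 0 & forall w, (w \in val P) = proportional v w.
Proof.
have /imsetP[v] := valP P; rewrite inE => v0 defP; exists v => // w.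
rewrite defP !inE; case: (boolP (proportional v w)); rewrite ?andbF // andbT.
by case/existsP=> a /andP[a0 /eqP->]; rewrite scaler_eq0 negb_or a0.
Qed.

Lemma proj_exists (P : proj K n) : exists v, v \in val P.
Proof.
have [v _ Pv] := projP P; exists v; rewrite Pv.
by apply/existsP; exists 1; rewrite oner_neq0 scale1r eqxx.
Qed.

Lemma proj_cover (v : 'rV[K]_n.+1) : v != 0 -> exists P : proj K n, v \in val P.
Proof.
move=> v0.
have PP : [set w in [set w | w != 0] | proportional v w] \in proj_points K n.
  by apply: imset_f; rewrite inE.
exists (exist (fun A => A \in proj_points K n) _ PP); rewrite /= !inE v0; apply/existsP; exists 1.
by rewrite oner_neq0 scale1r eqxx.
Qed.

Lemma proj_neq0 (P : proj K n) v : v \in val P -> v != 0.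
Proof.
have [u u0 ->] := projP P.
by case/existsP=> a /andP[a0 /eqP->]; rewrite scaler_eq0 negb_or a0.
Qed.

Lemma mem_proj (P : proj K n) v w : v \in val P ->
  (w \in val P) = proportional v w.
Proof.
have [u _ Pu] := projP P; rewrite !Pu => uv.
have /equivalence_relP[_ tr] := @proportional_equiv K n.
by rewrite (tr _ _ uv).
Qed.

Lemma proj_inj (P Q : proj K n) v : v \in val P -> v \in val Q -> P = Q.
Proof.
by move=> vP vQ; apply/val_inj/setP=> w; rewrite (mem_proj w vP) (mem_proj w vQ).
Qed.

(** The nonzero scalars act freely on nonzero vectors, and the class is one orbit. *)
Lemma card_proportional (v : 'rV[K]_n.+1) : v != 0 ->
  #|[set w | proportional v w]| = #|K|.-1.
Proof.
move=> v0; rewrite -(cardsC1 (0 : K)).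
have inj : {in [set~ 0] &, injective (fun a : K => a *: v)}.
  move=> a b _ _ /= /eqP; rewrite -subr_eq0 -scalerBl scaler_eq0 (negPf v0) orbF.
  by rewrite subr_eq0 => /eqP.
rewrite -(card_in_imset inj); apply: eq_card => w; rewrite inE.
apply/existsP/imsetP=> -[a].
  by case/andP=> a0 /eqP->; exists a; rewrite // !inE.
by rewrite !inE => a0 ->; exists a; rewrite a0 eqxx.
Qed.

Lemma card_proj : (#|{: proj K n}| * #|K|.-1 = (#|K| ^ n.+1).-1)%N.
Proof.
have eqv : {in [set v : 'rV[K]_n.+1 | v != 0] & &,
    equivalence_rel (@proportional K n)}.
  by move=> x y z _ _ _; apply: proportional_equiv.
have := card_uniform_partition (n := #|K|.-1) _ (equivalence_partitionP eqv).
have -> : #|[set v : 'rV[K]_n.+1 | v != 0]| = (#|K| ^ n.+1).-1.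
  have -> : [set v : 'rV[K]_n.+1 | v != 0] = [set~ 0].
    by apply/setP=> v; rewrite !inE.
  by rewrite cardsC1 card_mx mul1n.
rewrite card_sig => -> // A PA.
have [v v0 vE] := projP (Sub A PA : proj K n).
by rewrite -(card_proportional v0); apply: eq_card => w; rewrite inE -vE.
Qed.

End ProjectivePoints.

(** * The projective line: cardinality and equality test *)

Section ProjectiveLine.

Variable K : finFieldType.

Lemma card_proj1 : #|{: proj K 1}| = #|K|.+1.
Proof.
have := card_proj K 1; have := card_finRing_gt1 K.
case: #|K| => [|[|k]] // _ E; apply/eqP.
(* With [#|K|] = k + 2, cancel q - 1 = k + 1 from q^2 - 1 = (q - 1)(q + 1). *)
by rewrite -(eqn_pmul2r (ltn0Sn k)) [X in X == _]E -subn1 (subn_sqr _ 1) mulnC addn1.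
Qed.

(** The equation says that the determinant of the rows [v], [w] vanishes, which for nonzero vectors
    of the plane means proportionality. *)
Lemma proj1_eq (s t : proj K 1) v w : v \in val s -> w \in val t ->
  (v 0 0 * w 0 1 == v 0 1 * w 0 0) = (s == t).
Proof.
move=> vs wt; apply/eqP/eqP=> [E|st]; last first.
  move: wt; rewrite -st (mem_proj w vs) => /existsP[a /andP[_ /eqP->]].
  by rewrite !mxE mulrCA [RHS]mulrCA [v 0 1 * _]mulrC.
apply: (proj_inj (v := w)) => //; rewrite (mem_proj w vs).
have w0 := proj_neq0 wt; have v0 := proj_neq0 vs.
suff [a aw] : exists a, w = a *: v.
  apply/existsP; exists a; rewrite aw eqxx andbT.
  by apply: contraNneq w0 => a0; rewrite aw a0 scale0r.
have ord2 (u : 'rV[K]_2) j : u 0 j = if j == 0 then u 0 0 else u 0 1.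
  by case: eqP => [->//|/eqP]; case: j => -[|[|[]]] //= lt _; congr (u 0 _); apply/val_inj.
case: (eqVneq (v 0 0) 0) => [v00|v00].
  have v01 : v 0 1 != 0.
    apply: contraNneq v0 => v01; apply/eqP/rowP=> j.
    by rewrite ord2 v00 v01 mxE; case: ifP.
  exists (w 0 1 / v 0 1); apply/rowP=> j; rewrite mxE !(ord2 _ j).
  case: ifP; last by rewrite divfK.
  by move: E; rewrite v00 mul0r mulr0 => /esym/eqP; rewrite mulf_eq0 (negPf v01) => /eqP.
exists (w 0 0 / v 0 0); apply/rowP=> j; rewrite mxE !(ord2 _ j).
case: ifP; first by rewrite divfK.
by move=> _; apply: (mulfI v00); rewrite E [RHS]mulrC mulrAC divfK // mulrC.
Qed.

End ProjectiveLine.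

(** * Forms with prescribed values at the rational points *)

Section Interpolation.

Variable K : finFieldType.

Lemma expf_card_pred (x : K) : x ^+ #|K|.-1 = (x != 0)%:R.
Proof.
have K1 := card_finRing_gt1 K.
case: (eqVneq x 0) => [->|x0]; first by rewrite expr0n; case: #|K| K1 => [|[]].
by apply: (mulfI x0); rewrite -exprS prednK ?expf_card ?mulr1 // ltnW.
Qed.

Lemma dhomog_bigprod n m e (p : 'I_m -> {mpoly K[n]}) :
  (forall i, p i \is e.-homog) -> \prod_i p i \is (m * e).-homog.
Proof.
move=> pe; have <- : (\sum_(i < m) e = m * e)%N.
  by rewrite sum_nat_const card_ord.
apply: (big_ind2 (fun r d => r \is d.-homog)) => //; first exact: dhomog1.
by move=> p1 d1 p2 d2; apply: dhomogM.
Qed.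

(* If [v_k != 0], then [w] is proportional to [v] exactly when [w_k != 0] and
   every [v_k w_i - v_i w_k] vanishes; raising to the power [q - 1] turns these
   conditions into 0/1 values. The factor [i = k] is [x_k ^ (q - 1)]. *)
Lemma point_indicator n (v : 'rV[K]_n.+1) : v != 0 ->
  exists2 p : {mpoly K[n.+1]}, p \is (n.+1 * #|K|.-1).-homog
    & forall w : 'rV[K]_n.+1, p.@[w 0] = (proportional v w)%:R.
Proof.
move=> v0; have [k vk] : exists k, v 0 k != 0 by apply/rV0Pn.
pose l i : {mpoly K[n.+1]} := v 0 k *: 'X_i - v 0 i *: 'X_k.
have Xh i : ('X_i : {mpoly K[n.+1]}) \is 1.-homog by rewrite dhomogX /= mdeg1.
have powh e (r : {mpoly K[n.+1]}) : r \is 1.-homog -> r ^+ e \is e.-homog.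
  by move=> /(dhomogMn e); rewrite mul1n.
have lh i : l i \is 1.-homog by rewrite rpredB ?rpredZ.
have lE w i : (l i).@[w 0] = v 0 k * w 0 i - v 0 i * w 0 k.
  by rewrite mevalB !mevalZ !mevalXU.
exists (\prod_i ('X_k ^+ #|K|.-1 - l i ^+ #|K|.-1)).
  apply: dhomog_bigprod => i.
  by apply: rpredB; apply: powh.
move=> w; rewrite rmorph_prod /=.
rewrite (eq_bigr (fun i =>
    (w 0 k != 0)%:R - (v 0 k * w 0 i != v 0 i * w 0 k)%:R)).
  case: (boolP (proportional v w)) => [/existsP[a /andP[a0 /eqP->]]|vw].
    rewrite big1 // => i _; rewrite !mxE mulf_neq0 // mulrCA [_ * (a * _)]mulrCA.
    by rewrite [v 0 i * _]mulrC eqxx subr0.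
  have [wk|wk] := eqVneq (w 0 k) 0.
    by rewrite (bigD1 k) //= wk !mulr0 eqxx subr0 mul0r.
  have [i iP] : exists i, v 0 k * w 0 i != v 0 i * w 0 k.
    apply/existsP; apply: contraNT vw => /existsPn eqw; apply/existsP.
    exists (w 0 k / v 0 k); rewrite mulf_neq0 ?invr_eq0 //=.
    apply/eqP/rowP=> i; apply: (mulfI vk).
    by rewrite mxE mulrA [_ * (_ / _)]mulrC divfK // (eqP (negPn (eqw i))) mulrC.
  by rewrite (bigD1 i) //= iP subrr mul0r.
by move=> i _; rewrite mevalB !rmorphXn /= lE mevalXU !expf_card_pred subr_eq0.
Qed.

(** Lagrange interpolation with the point indicators. Their degree is a multiple of q - 1, so the
    value does not change with the representative of the point. *)
Lemma proj_interpolation n (f : proj K n -> K) :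
  exists2 p : {mpoly K[n.+1]}, p \is (n.+1 * #|K|.-1).-homog
    & forall (P : proj K n) v, v \in val P -> p.@[v 0] = f P.
Proof.
have /fin_all_exists2[p ph pE] (P : proj K n) :
    exists2 p : {mpoly K[n.+1]}, p \is (n.+1 * #|K|.-1).-homog
      & forall w : 'rV[K]_n.+1, p.@[w 0] = (w \in val P)%:R.
  have [v v0 Pv] := projP P; have [p ph pE] := point_indicator v0.
  by exists p => // w; rewrite pE Pv.
exists (\sum_P f P *: p P).
  by apply: rpred_sum => P _; apply/dhomogZ/ph.
move=> P v vP; rewrite raddf_sum (bigD1 P) //= big1 ?addr0.
  by rewrite mevalZ pE vP mulr1.
move=> Q QP; rewrite mevalZ pE; case: (boolP (v \in val Q)); rewrite ?mulr0 //.
by move=> vQ; rewrite (proj_inj vP vQ) eqxx in QP.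
Qed.

(* The witness is [x_0 ^ (d - q - 1) * (x_0 x_1 ^ q - x_0 ^ q x_1)]. *)
Lemma vanishing_form n d : (#|K| < d)%N ->
  exists p : {mpoly K[n.+2]},
    [/\ p != 0, p \is d.-homog & forall v, p.@[v] = 0].
Proof.
move=> Kd; have K1 := card_finRing_gt1 K.
pose m a b : 'X_{1..n.+2} := (U_(0%R) *+ a + U_(1%R) *+ b)%MM.
have md a b : mdeg (m a b) = (a + b)%N.
  by rewrite mdegD !mdegMn !mdeg1 !mul1n.
have mE a b v : 'X_[m a b].@[v] = v 0 ^+ a * v 1 ^+ b :> K.
  by rewrite mpolyXD mevalM -!mpolyXn !rmorphXn /= !mevalXU.
exists ('X_[m (d - #|K|)%N #|K|] - 'X_[m d.-1 1%N]); split.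
- apply/eqP=> /(congr1 (mcoeff (m d.-1 1%N))).
  (* The two monomials differ in the exponent of x_1, which is q in one and 1 in the other. *)
  rewrite mcoeffB !mcoeffX mcoeff0 eqxx; case: eqVneq => [/mnmP/(_ 1%R)|_ /eqP].
    rewrite !mnmDE !mulmnE !mnm1E /= !mul0n !mul1n !add0n => q1.
    by rewrite q1 in K1.
  by rewrite sub0r oppr_eq0 oner_eq0.
- rewrite rpredB // dhomogX /= md ?subnK ?(ltnW Kd) //.
  by rewrite addn1 prednK ?(leq_ltn_trans _ Kd).
move=> v; rewrite mevalB !mE expf_card expr1; apply/eqP; rewrite subr_eq0; apply/eqP.
(* Writing d = e + q + 1, the powers of x_0 agree since x^(e + q) = x^e x = x^(e + 1). *)
congr (_ * _); have [e ->] : exists e, d = (e + #|K|).+1.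
  by exists (d - #|K|.+1)%N; rewrite -addnS subnK.
by rewrite -addSn addnK /= exprD expf_card exprSr.
Qed.

End Interpolation.

(** * Linear independence of the generators *)

Section Pencils.

Variable K : finFieldType.

(** [pencil_perturb] modifies only the second generator; the swap lets it serve for the first as
    well. *)
Lemma pencil_sym d (F G : {mpoly K[3]}) : is_pencil d F G -> is_pencil d G F.
Proof.
by case=> d0 Fd Gd FG; split=> // a b; rewrite addrC => /FG[].
Qed.

(* If both [F, G] and [F, G + H] were dependent, then [H] would be a multiple
   of [F], hence zero since it vanishes where [F] does not. *)
Lemma pencil_perturb d (F G H : {mpoly K[3]}) v :
    (0 < d)%N -> F \is d.-homog -> G \is d.-homog -> H \is d.-homog ->
    H != 0 -> F.@[v] != 0 -> H.@[v] = 0 ->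
  is_pencil d F G \/ is_pencil d F (G + H).
Proof.
move=> d0 Fd Gd Hd H0 Fv Hv.
have F0 : F != 0 by apply: contraNneq Fv => ->; rewrite meval0.
have indep G' : G' \is d.-homog -> is_pencil d F G' \/ exists c, G' = c *: F.
  move=> Gd'; case: (pickP (fun c => G' == c *: F)) => [c /eqP->|nG].
    by right; exists c.
  left; split=> // a b E; have b0 : b = 0.
    apply/eqP; apply/negPn/negP=> b0; have /eqP := nG (- (a / b)); case.
    apply: (scalerI b0); rewrite scalerA mulrN mulrCA divff // mulr1 scaleNr.
    by apply/eqP; rewrite -addr_eq0 addrC E.
  by move/eqP: E; rewrite b0 scale0r addr0 scaler_eq0 (negPf F0) orbF => /eqP.
case: (indep G Gd) => [|[c Gc]]; first by left.
case: (indep (G + H)) => [||[c' GHc]]; first exact: rpredD; first by right.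
have HF : H = (c' - c) *: F by rewrite scalerBl -GHc -Gc addrC addKr.
move/eqP: Hv; rewrite HF mevalZ mulf_eq0 (negPf Fv) orbF => /eqP c0.
by rewrite HF c0 scale0r eqxx in H0.
Qed.

End Pencils.

(** * The pencil attached to a partition *)

Theorem proposition2p1 (q : nat) (K : finFieldType) (cardK : #|K| = q)
    (U : 'I_q.+1 -> {set proj K 2}) (partU : is_partition U) :
  exists (d : nat) (F G : {mpoly K[3]}),
    [/\ is_pencil d F G, base_point_free F G & induces F G U].
Proof.
have [disjU coverU] := partU.
have /fin_all_exists[idx idxP] (P : proj K 2) : exists i, P \in U i.
  have : P \in \bigcup_i U i by rewrite coverU inE.
  by case/bigcupP=> i _; exists i.
have UE P i : (P \in U i) = (i == idx P).
  apply/idP/eqP=> [Pi|->//]; apply/eqP/negPn/negP.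
  move=> /disjU/disjoint_setI0/setP/(_ P).
  by rewrite !inE Pi idxP.
have cardq : #|{: proj K 1}| = q.+1 by rewrite card_proj1 cardK.
pose sigma (st : proj K 1) := cast_ord cardq (enum_rank st).
pose tau i : proj K 1 := enum_val (cast_ord (esym cardq) i).
have sigmaK : cancel sigma tau by move=> st; rewrite /tau cast_ordK enum_rankK.
have tauK : cancel tau sigma by move=> i; rewrite /sigma enum_valK cast_ordKV.
have /fin_all_exists[c cP] := @proj_exists K 1.
(* Both interpolants take their coordinates from the same representative of the point of the line
   attached to the block of [P]. *)
pose f P := c (tau (idx P)).
have [F0 F0d F0E] := proj_interpolation (fun P => f P 0 1).
have [G0 G0d G0E] := proj_interpolation (fun P => - f P 0 0).
set d := (3 * #|K|.-1)%N in F0d G0d; have K1 := card_finRing_gt1 K.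
(* 3(q - 1) >= q + 1 because q >= 2, with equality at q = 2; this leaves room for a vanishing form
   of degree [d]. *)
have Kd : (#|K| < d)%N.
  rewrite /d; case: #|K| K1 => [|[|k]] //= _.
  by rewrite mulSn -[k.+2]addn1 -addnS leq_add2l leq_pmulr.
have d0 : (0 < d)%N by apply: leq_ltn_trans Kd.
have [H [H0 Hd Hv]] := vanishing_form 1 Kd.
have [F [G [FGp FE GE]]] : exists F G : {mpoly K[3]},
    [/\ is_pencil d F G, forall v, F.@[v] = F0.@[v]
      & forall v, G.@[v] = G0.@[v]].
  have pE (p : {mpoly K[3]}) v : (p + H).@[v] = p.@[v] by rewrite mevalD Hv addr0.
  have [v v0] : exists v : 'rV[K]_3, v != 0.
    by exists (const_mx 1); apply/rV0Pn; exists 0; rewrite mxE oner_neq0.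
  have [P vP] := proj_cover v0.
  (* At any point one of [F0], [G0] is nonzero, as their values are, up to sign, the coordinates of
     a nonzero vector. That one is kept and [H] is added, if necessary, to the other. *)
  have [Fv|Fv] := eqVneq (F0.@[v 0]) 0.
    have Gv : G0.@[v 0] != 0.
      apply: contraNneq (proj_neq0 (cP (tau (idx P)))) => Gv; apply/eqP/rowP=> j.
      move: Fv Gv; rewrite (F0E P) // (G0E P) // mxE /f => Fv /eqP.
      rewrite oppr_eq0 => /eqP Gv; case: j => -[|[|[]]] //= lt.
        by rewrite -[RHS]Gv; congr (c _ 0 _); apply/val_inj.
      by rewrite -[RHS]Fv; congr (c _ 0 _); apply/val_inj.
    case: (pencil_perturb d0 G0d F0d Hd H0 Gv (Hv _)) => /pencil_sym p.
      by exists F0, G0.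
    by exists (F0 + H), G0; split=> // w; rewrite pE.
  case: (pencil_perturb d0 F0d G0d Hd H0 Fv (Hv _)) => p; first by exists F0, G0.
  by exists F0, (G0 + H); split=> // w; rewrite pE.
have FP (P : proj K 2) v : v \in val P -> F.@[v 0] = f P 0 1 by rewrite FE; apply: F0E.
have GP (P : proj K 2) v : v \in val P -> G.@[v 0] = - f P 0 0 by rewrite GE; apply: G0E.
have memE st P : (P \in member F G st) = (st == tau (idx P)).
  (* The value of the member at [P] is the determinant of [s] and the chosen representative of
     [tau (idx P)]. *)
  have step s v : s \in val st -> v \in val P ->
      ((s 0 0 *: F + s 0 1 *: G).@[v 0] == 0) = (st == tau (idx P)).
    move=> sst vP; rewrite mevalD !mevalZ (FP P) // (GP P) // mulrN subr_eq0.
    exact: proj1_eq sst (cP _).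
  rewrite inE; apply/forall_inP/idP=> [all0|E s sst].
    have [v vP] := proj_exists P; rewrite -(step _ v (cP st) vP).
    exact: (forall_inP (all0 _ (cP st))).
  by apply/forall_inP=> v vP; rewrite step.
exists d, F, G; split=> //.
  case=> P [/forall_inP FP0 /forall_inP GP0].
  have [v vP] := proj_exists P.
  (* A base point would lie on every member, but [memE] allows only one. The members attached to the
     first and last indices are distinct since q > 0. *)
  have memP st : P \in member F G st.
    rewrite inE; apply/forall_inP=> s _; apply/forall_inP=> w wP.
    by rewrite mevalD !mevalZ (eqP (FP0 w wP)) (eqP (GP0 w wP)) !mulr0 addr0.
  have /eqP E0 := etrans (esym (memE (tau ord0) P)) (memP _).
  have /eqP E1 := etrans (esym (memE (tau ord_max) P)) (memP _).
  have := congr1 (fun st => val (sigma st)) (etrans E0 (esym E1)).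
  by rewrite !tauK /= => q0; rewrite cardK -q0 in K1.
exists sigma; split; first by exists tau.
by move=> st; apply/setP=> P; rewrite memE UE (can2_eq sigmaK tauK).
Qed.
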